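(* Let $E$ be a unital Banach algebra, $1\in B\subset E$ a Banach subalgebra and $Y\in E$, such that $\mathcal{RA}(Y;B)$ is dense in $E$ and carries a GDQ ring structure with comultiplication $\partial$ satisfying $\partial B=0$ and $\partial Y=1\otimes1$. If $\varphi\in E'$ and $b_1\in\rho_m(Y;B)$, $b_2\in\rho_n(Y;B)$, then $$(\varphi\otimes\mathrm{id}_{\mathfrak{M}_m}\otimes\mathrm{id}_{\mathfrak{M}_n})\bigl(R_m(Y;B)(b_1)\otimes_ER_n(Y;B)(b_2)\bigr)=-\partial_{m,n}(U_{m+n}(\varphi))(b_1;b_2).$$
   Context: $\mathfrak{M}_n(E)=\mathfrak{M}_n\otimes E$ is the algebra of $n\times n$ matrices over $E$, and $Y\otimes I_n$ is the diagonal matrix with diagonal entries $Y$. The $n$-th $B$-resolvent set of $Y$ is $\rho_n(Y;B)=\{b\in\mathfrak{M}_n(B): Y\otimes I_n-b\text{ is invertible in }\mathfrak{M}_n(E)\}$, and the $n$-th $B$-resolvent is $R_n(Y;B)(b)=(b-Y\otimes I_n)^{-1}$ for $b\in\rho_n(Y;B)$. $\mathcal{RA}(Y;B)$ is the subalgebra of $E$ generated by $B$, $Y$ and all the matrix entries of the $R_n(Y;B)(b)$, $n\ge1$, $b\in\rho_n(Y;B)$. A GDQ ring structure on an algebra $A$ (multiplication $\mu$) is a linear map $\partial:A\to A\otimes A$ (algebraic tensor product) which is coassociative, $(\partial\otimes\mathrm{id})\circ\partial=(\mathrm{id}\otimes\partial)\circ\partial$, and a derivation, $\partial\circ\mu=(\mathrm{id}\otimes\mu)\circ(\partial\otimes\mathrm{id})+(\mu\otimes\mathrm{id})\circ(\mathrm{id}\otimes\partial)$.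 $E'$ is the dual of the Banach space $E$. For $\varphi\in E'$, $U_n(\varphi):\rho_n(Y;B)\to\mathfrak{M}_n$ is $U_n(\varphi)(b)=(\varphi\otimes\mathrm{id}_{\mathfrak{M}_n})(R_n(Y;B)(b))$ ($\varphi$ applied to each matrix entry); it is analytic and equivariant under conjugation by $GL(n;\mathbb{C})$. For $x=\sum_{i,j}x_{ij}\otimes e^{(m)}_{ij}\in\mathfrak{M}_m(E)$ and $x'=\sum_{k,l}x'_{kl}\otimes e^{(n)}_{kl}\in\mathfrak{M}_n(E)$, $x\otimes_Ex'=\sum_{i,j,k,l}e^{(m)}_{ij}\otimes e^{(n)}_{kl}\otimes(x_{ij}x'_{kl})\in\mathfrak{M}_m\otimes\mathfrak{M}_n\otimes E$; in the formula of the claim $\varphi$ is applied to the $E$-component. For an analytic $GL(m+n;\mathbb{C})$-equivariant $f:\rho_{m+n}(Y;B)\to\mathfrak{M}_{m+n}$ and $b_1\in\rho_m(Y;B)$, $b_2\in\rho_n(Y;B)$, $$(\partial_{m,n}f)(b_1;b_2)=\sum_{1\le i,j\le m}\ \sum_{1\le k,l\le n}\Bigl(\tfrac{d}{d\varepsilon}f(b_1\oplus b_2+\varepsilon e_{j,k+m}\otimes1)\big|_{\varepsilon=0}\Bigr)_{i,m+l}\,e^{(m)}_{ij}\otimes e^{(n)}_{kl}\in\mathfrak{M}_m\otimes\mathfrak{M}_n,$$ where $(\cdot)_{i,m+l}$ is the $(i,m+l)$ entry, $e_{j,k+m}$ a matrix unit of $\mathfrak{M}_{m+n}$, and $e^{(m)}_{ij},e^{(n)}_{kl}$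 the matrix units of $\mathfrak{M}_m,\mathfrak{M}_n$. *)

(* Defs.v *)
From HB Require Import structures.
From mathcomp Require Import all_boot all_order all_algebra.
From mathcomp Require Import generic_quotient.
From mathcomp Require Import complex mxtens.
From mathcomp Require Import boolp classical_sets reals topology normedtype derive.

Set Implicit Arguments.
Unset Strict Implicit.
Unset Printing Implicit Defensive.

Import Order.TTheory GRing.Theory Num.Theory.
Import numFieldNormedType.Exports.

Local Open Scope classical_set_scope.
Local Open Scope quotient_scope.
Local Open Scope ring_scope.

(* The algebraic tensor product of two K-modules: finite formal sums
   a_1 (x) b_1 + ... + a_r (x) b_r, represented by sequences of pairs, modulo
   the congruence generated by commutativity and K-bilinearity. *)
Section Tensor.
Variables (K : comNzRingType) (A B : lmodType K).

Inductive tensor_eq : seq (A * B) -> seq (A * B) -> Prop :=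
| tensor_eq_refl s : tensor_eq s s
| tensor_eq_sym s t : tensor_eq s t -> tensor_eq t s
| tensor_eq_trans s t u : tensor_eq s t -> tensor_eq t u -> tensor_eq s u
| tensor_eq_cat s s' t t' :
    tensor_eq s s' -> tensor_eq t t' -> tensor_eq (s ++ t) (s' ++ t')
| tensor_eq_catC s t : tensor_eq (s ++ t) (t ++ s)
| tensor_eq_0l b : tensor_eq [:: (0, b)] [::]
| tensor_eq_Dl a a' b : tensor_eq [:: (a + a', b)] [:: (a, b); (a', b)]
| tensor_eq_Dr a b b' : tensor_eq [:: (a, b + b')] [:: (a, b); (a, b')]
| tensor_eq_Z c a b : tensor_eq [:: (c *: a, b)] [:: (a, c *: b)].

Definition tensor_eqb (s t : seq (A * B)) : bool := `[< tensor_eq s t >].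

Lemma tensor_eqb_refl : reflexive tensor_eqb.
Proof. by move=> s; apply/asboolP; apply: tensor_eq_refl. Qed.

Lemma tensor_eqb_sym : symmetric tensor_eqb.
Proof.
by move=> s t; apply/asboolP/asboolP => /tensor_eq_sym.
Qed.

Lemma tensor_eqb_trans : transitive tensor_eqb.
Proof.
move=> t s u /asboolP st /asboolP tu.
by apply/asboolP; apply: tensor_eq_trans st tu.
Qed.

Canonical tensor_equiv :=
  EquivRel tensor_eqb tensor_eqb_refl tensor_eqb_sym tensor_eqb_trans.

Definition tensor := {eq_quot tensor_equiv}.

HB.instance Definition _ := Choice.on tensor.
HB.instance Definition _ := EqQuotient.on tensor.

Definition tensor_of_seq (s : seq (A * B)) : tensor := \pi_tensor s.

Definition tens (a : A) (b : B) : tensor := tensor_of_seq [:: (a, b)].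

Definition tensor_zero : tensor := tensor_of_seq [::].

Definition tensor_add (x y : tensor) : tensor :=
  tensor_of_seq (repr x ++ repr y).

Definition tensor_scale (c : K) (x : tensor) : tensor :=
  tensor_of_seq [seq (c *: p.1, p.2) | p <- repr x].

Definition tensor_opp (x : tensor) : tensor := tensor_scale (-1) x.

Lemma tensor_of_seqP s t : tensor_of_seq s = tensor_of_seq t <-> tensor_eq s t.
Proof.
split; first by move/eqmodP => /= /asboolP.
by move=> st; apply/eqmodP; apply/asboolP.
Qed.

Lemma tensor_of_seq_repr x : tensor_of_seq (repr x) = x.
Proof. exact: reprK. Qed.

Lemma repr_tensor_of_seq s : tensor_eq (repr (tensor_of_seq s)) s.
Proof. by apply/tensor_of_seqP; rewrite tensor_of_seq_repr. Qed.

Lemma tensor_addE s t :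
  tensor_add (tensor_of_seq s) (tensor_of_seq t) = tensor_of_seq (s ++ t).
Proof.
by apply/tensor_of_seqP; apply: tensor_eq_cat; apply: repr_tensor_of_seq.
Qed.

Lemma tensor_eq_scale c s t : tensor_eq s t ->
  tensor_eq [seq (c *: p.1, p.2) | p <- s] [seq (c *: p.1, p.2) | p <- t].
Proof.
elim=> {s t} /=.
- by move=> s; apply: tensor_eq_refl.
- by move=> s t _; apply: tensor_eq_sym.
- by move=> s t u _ st _; apply: tensor_eq_trans.
- by move=> s s' t t' _ ss _ tt; rewrite !map_cat; apply: tensor_eq_cat.
- by move=> s t; rewrite !map_cat; apply: tensor_eq_catC.
- by move=> b; rewrite scaler0; apply: tensor_eq_0l.
- by move=> a a' b; rewrite scalerDr; apply: tensor_eq_Dl.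
- by move=> a b b'; apply: tensor_eq_Dr.
- move=> d a b; rewrite scalerA mulrC -scalerA; exact: tensor_eq_Z.
Qed.

Lemma tensor_scaleE c s : tensor_scale c (tensor_of_seq s) =
  tensor_of_seq [seq (c *: p.1, p.2) | p <- s].
Proof.
by apply/tensor_of_seqP/tensor_eq_scale; apply: repr_tensor_of_seq.
Qed.

Lemma tensor_ind (P : tensor -> Prop) :
  (forall s, P (tensor_of_seq s)) -> forall x, P x.
Proof. by move=> Ps x; rewrite -[x]tensor_of_seq_repr. Qed.

Lemma tensor_addA : associative tensor_add.
Proof.
elim/tensor_ind=> s; elim/tensor_ind=> t; elim/tensor_ind=> u.
by rewrite !tensor_addE catA.
Qed.

Lemma tensor_addC : commutative tensor_add.
Proof.
elim/tensor_ind=> s; elim/tensor_ind=> t; rewrite !tensor_addE.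
by apply/tensor_of_seqP; apply: tensor_eq_catC.
Qed.

Lemma tensor_add0 : left_id tensor_zero tensor_add.
Proof. by elim/tensor_ind=> s; rewrite tensor_addE. Qed.

Lemma tensor_scaleDl c d x :
  tensor_scale (c + d) x = tensor_add (tensor_scale c x) (tensor_scale d x).
Proof.
elim/tensor_ind: x => s; rewrite !tensor_scaleE tensor_addE.
elim: s => [|[a b] s IHs]; first by [].
have consE x u : tensor_of_seq (x :: u) =
    tensor_add (tensor_of_seq [:: x]) (tensor_of_seq u) by rewrite tensor_addE.
rewrite -!tensor_addE /= in IHs *.
rewrite consE IHs (consE (c *: a, b)) (consE (d *: a, b)).
have -> : tensor_of_seq [:: ((c + d) *: a, b)] =
  tensor_add (tensor_of_seq [:: (c *: a, b)]) (tensor_of_seq [:: (d *: a, b)]).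
  by rewrite tensor_addE; apply/tensor_of_seqP; rewrite scalerDl;
    apply: tensor_eq_Dl.
rewrite -!tensor_addA; congr tensor_add.
by rewrite !tensor_addA; congr tensor_add; rewrite tensor_addC.
Qed.

Lemma tensor_scaleDr c : {morph tensor_scale c : x y / tensor_add x y}.
Proof.
elim/tensor_ind=> s; elim/tensor_ind=> t.
by rewrite tensor_addE !tensor_scaleE map_cat tensor_addE.
Qed.

Lemma tensor_scaleA c d x :
  tensor_scale c (tensor_scale d x) = tensor_scale (c * d) x.
Proof.
elim/tensor_ind: x => s; rewrite !tensor_scaleE -map_comp.
by congr tensor_of_seq; apply: eq_map => p /=; rewrite scalerA.
Qed.

Lemma tensor_scale1 : left_id 1 tensor_scale.
Proof.
elim/tensor_ind=> s; rewrite tensor_scaleE; congr tensor_of_seq.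
by rewrite -[RHS]map_id; apply: eq_map => -[a b] /=; rewrite scale1r.
Qed.

Lemma tensor_scale0 x : tensor_scale 0 x = tensor_zero.
Proof.
elim/tensor_ind: x => s; rewrite tensor_scaleE.
elim: s => [//|[a b] s IHs]; rewrite -cat1s map_cat -tensor_addE IHs /=.
rewrite scale0r tensor_addE cats0; apply/tensor_of_seqP; exact: tensor_eq_0l.
Qed.

Lemma tensor_addN : left_inverse tensor_zero tensor_opp tensor_add.
Proof.
move=> x; rewrite /tensor_opp -{2}[x]tensor_scale1 -tensor_scaleDl addNr.
exact: tensor_scale0.
Qed.

HB.instance Definition _ :=
  GRing.isZmodule.Build tensor tensor_addA tensor_addC tensor_add0 tensor_addN.

HB.instance Definition _ :=
  GRing.Zmodule_isLmodule.Build K tensor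
    tensor_scaleA tensor_scale1 tensor_scaleDr
    (fun x => fun c d => tensor_scaleDl c d x).

Definition bilinear_map (W : lmodType K) (f : A -> B -> W) : Prop :=
  (forall b, linear (f^~ b)) /\ (forall a, linear (f a)).

Lemma tens_bilinear : bilinear_map tens.
Proof.
split=> [b c a a'|a c b b'].
  change (tens (c *: a + a') b =
    tensor_add (tensor_scale c (tens a b)) (tens a' b)).
  rewrite /tens tensor_scaleE tensor_addE /=; apply/tensor_of_seqP.
  exact: tensor_eq_Dl.
change (tens a (c *: b + b') =
  tensor_add (tensor_scale c (tens a b)) (tens a b')).
rewrite /tens tensor_scaleE tensor_addE /=; apply/tensor_of_seqP.
apply: tensor_eq_trans (tensor_eq_Dr _ _ _) _.
exact: tensor_eq_cat (tensor_eq_sym (tensor_eq_Z c a b))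
  (tensor_eq_refl [:: (a, b')]).
Qed.

Lemma tensor_of_seqE s : tensor_of_seq s = \sum_(p <- s) tens p.1 p.2.
Proof.
elim: s => [|[a b] s IHs]; first by rewrite big_nil.
by rewrite big_cons -IHs -cat1s -tensor_addE.
Qed.

(* The map sending a (x) b to f a b. It is well defined, i.e. independent of
   the representative chosen by [repr], as soon as f is bilinear
   ([tensor_lift_tens]), the only case in which it is used. *)
Definition tensor_lift (W : lmodType K) (f : A -> B -> W) (t : tensor) : W :=
  \sum_(p <- repr t) f p.1 p.2.

Section Lift.
Variables (W : lmodType K) (f : A -> B -> W).
Hypothesis fB : bilinear_map f.

Lemma tensor_lift_of_seq s :
  tensor_lift f (tensor_of_seq s) = \sum_(p <- s) f p.1 p.2.
Proof.
have [fl fr] := fB.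
suff sumP u v : tensor_eq u v ->
    \sum_(p <- u) f p.1 p.2 = \sum_(p <- v) f p.1 p.2.
  exact: sumP (repr_tensor_of_seq s).
elim=> {u v} //.
- by move=> u v w _ -> _ ->.
- by move=> u u' v v' _ IHu _ IHv; rewrite !big_cat /= IHu IHv.
- by move=> u v; rewrite !big_cat /= addrC.
- move=> b; rewrite big_seq1 big_nil /=.
  by have := fl b (-1) 0 0; rewrite /= !scaleN1r oppr0 addr0 addNr.
- move=> a a' b; rewrite !big_cons !big_nil !addr0 /=.
  by have := fl b 1 a a'; rewrite /= !scale1r.
- move=> a b b'; rewrite !big_cons !big_nil !addr0 /=.
  by have := fr a 1 b b'; rewrite /= !scale1r.
- move=> c a b; rewrite !big_seq1 /=.
  have f0l : f 0 b = 0.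
    by have := fl b (-1) 0 0; rewrite /= !scaleN1r oppr0 addr0 addNr.
  have f0r : f a 0 = 0.
    by have := fr a (-1) 0 0; rewrite /= !scaleN1r oppr0 addr0 addNr.
  have := fl b c a 0; rewrite /= addr0 f0l addr0 => ->.
  by have := fr a c b 0; rewrite /= addr0 f0r addr0 => ->.
Qed.

Lemma tensor_lift_tens a b : tensor_lift f (tens a b) = f a b.
Proof. by rewrite tensor_lift_of_seq big_seq1. Qed.

Lemma tensor_lift_linear : linear (tensor_lift f).
Proof.
have [fl fr] := fB.
move=> c; elim/tensor_ind=> s; elim/tensor_ind=> t.
change (tensor_lift f
    (tensor_add (tensor_scale c (tensor_of_seq s)) (tensor_of_seq t)) =
  c *: tensor_lift f (tensor_of_seq s) + tensor_lift f (tensor_of_seq t)).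
rewrite tensor_scaleE tensor_addE !tensor_lift_of_seq big_cat /= big_map.
congr (_ + _); rewrite scaler_sumr; apply: eq_bigr => -[a b] _ /=.
have := fl b c a 0; rewrite /= addr0 => ->.
suff -> : f 0 b = 0 by rewrite addr0.
by have := fl b (-1) 0 0; rewrite /= !scaleN1r oppr0 addr0 addNr.
Qed.

End Lift.
End Tensor.

Section TensorMaps.
Variable K : comNzRingType.

Definition tensor_map (A A' B B' : lmodType K) (f : A -> A') (g : B -> B') :
    tensor A B -> tensor A' B' :=
  tensor_lift (fun a b => tens (f a) (g b)).

Definition tensor_assoc (A B C : lmodType K) :
    tensor (tensor A B) C -> tensor A (tensor B C) :=
  tensor_lift (fun t c => tensor_lift (fun a b => tens a (tens b c)) t).

Definition tensor_assocV (A B C : lmodType K) :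
    tensor A (tensor B C) -> tensor (tensor A B) C :=
  tensor_lift (fun a t => tensor_lift (fun b c => tens (tens a b) c) t).

Lemma tensor_map_tens (A A' B B' : lmodType K) (f : {linear A -> A'})
    (g : {linear B -> B'}) a b :
  tensor_map f g (tens a b) = tens (f a) (g b).
Proof.
have [tl tr] := @tens_bilinear K A' B'.
apply: (tensor_lift_tens (f := fun a b => tens (f a) (g b))); split=> [y|x] c u v.
  by rewrite linearP; apply: tl.
by rewrite linearP; apply: tr.
Qed.

Lemma tensor_lift_comb (A B W : lmodType K) (f g h : A -> B -> W) c t :
  (forall a b, h a b = c *: f a b + g a b) ->
  tensor_lift h t = c *: tensor_lift f t + tensor_lift g t.
Proof.
move=> hE; rewrite /tensor_lift scaler_sumr -big_split /=.
by apply: eq_bigr => p _; apply: hE.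
Qed.

Lemma tensor_assoc_tens (A B C : lmodType K) (a : A) (b : B) (c : C) :
  tensor_assoc (tens (tens a b) c) = tens a (tens b c).
Proof.
have [tl tr] := @tens_bilinear K A (tensor B C).
have [ul ur] := @tens_bilinear K B C.
have fB (z : C) : bilinear_map (fun (x : A) (y : B) => tens x (tens y z)).
  split=> [y|x] k u v; first exact: (tl (tens y z)).
  by have /= -> := ul z k u v; exact: (tr x k).
rewrite /tensor_assoc tensor_lift_tens; first exact: tensor_lift_tens (fB c) a b.
split=> [z|t] k u v; first exact: tensor_lift_linear.
apply: tensor_lift_comb => x y.
by have /= -> := ur y k u v; exact: (tr x k).
Qed.

Lemma tensor_assocV_tens (A B C : lmodType K) (a : A) (b : B) (c : C) :
  tensor_assocV (tens a (tens b c)) = tens (tens a b) c.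
Proof.
have [tl tr] := @tens_bilinear K (tensor A B) C.
have [ul ur] := @tens_bilinear K A B.
have fB (x : A) : bilinear_map (fun (y : B) (z : C) => tens (tens x y) z).
  split=> [z|y] k u v; last exact: (tr (tens x y)).
  by have /= -> := ur x k u v; exact: (tl z k).
rewrite /tensor_assocV tensor_lift_tens; first exact: tensor_lift_tens (fB a) b c.
split=> [t|x] k u v; last exact: tensor_lift_linear.
apply: tensor_lift_comb => y z.
by have /= -> := ul y k u v; exact: (tl z k).
Qed.

(* The multiplication of A, as a map on the tensor square. *)
Definition tensor_mul (A : algType K) : tensor A A -> A :=
  tensor_lift (fun a b : A => a * b).

Lemma tensor_mul_tens (A : algType K) (a b : A) : tensor_mul (tens a b) = a * b.
Proof.
apply: (tensor_lift_tens (f := fun a b : A => a * b)); split=> [y|x] c u v.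
  by rewrite mulrDl scalerAl.
by rewrite mulrDr scalerAr.
Qed.

(* (A (x) A) (x) A and A (x) (A (x) A) are identified through [tensor_assoc]. *)
Record GDQ_ring (A : algType K) (d : {linear A -> tensor A A}) : Prop := GDQRing {
  GDQ_coassociative : forall a : A,
    tensor_assoc (tensor_map d idfun (d a)) = tensor_map idfun d (d a);
  GDQ_derivation : forall t : tensor A A,
    d (tensor_mul t) =
      tensor_map idfun (@tensor_mul A) (tensor_assoc (tensor_map d idfun t))
      + tensor_map (@tensor_mul A) idfun (tensor_assocV (tensor_map idfun d t))
}.

End TensorMaps.

(* A unital Banach algebra, as a complete normed space with a multiplication.
   [GRing.Algebra] and [NormedModule] cannot be joined into one structure of
   the hierarchy, because [Num.NumDomain] already inherits from both rings and
   normed modules; hence the record, whose carrier gets both structures below.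
   The norm of 1 is not required to be 1. *)
Record banachAlgebra (K : numFieldType) := BanachAlgebra {
  banach_space : completeNormedModType K;
  banach_one : banach_space;
  banach_mul : banach_space -> banach_space -> banach_space;
  banach_mulA : associative banach_mul;
  banach_mul1 : left_id banach_one banach_mul;
  banach_mulr1 : right_id banach_one banach_mul;
  banach_mulDl : left_distributive banach_mul +%R;
  banach_mulDr : right_distributive banach_mul +%R;
  banach_one_neq0 : banach_one != 0;
  banach_scaleAl : forall (c : K) x y,
    c *: banach_mul x y = banach_mul (c *: x) y;
  banach_scaleAr : forall (c : K) x y,
    c *: banach_mul x y = banach_mul x (c *: y);
  banach_normM : forall x y, `|banach_mul x y| <= `|x| * `|y|
}.

Definition banach_sort (K : numFieldType) (A : banachAlgebra K) : Type :=
  banach_space A.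
Coercion banach_sort : banachAlgebra >-> Sortclass.

Section BanachAlgebraInstances.
Variables (K : numFieldType) (A : banachAlgebra K).

HB.instance Definition _ := CompleteNormedModule.on (banach_sort A).
HB.instance Definition _ := GRing.Zmodule_isNzRing.Build (banach_sort A)
  (@banach_mulA K A) (@banach_mul1 K A) (@banach_mulr1 K A)
  (@banach_mulDl K A) (@banach_mulDr K A) (@banach_one_neq0 K A).
HB.instance Definition _ :=
  GRing.Lmodule_isLalgebra.Build K (banach_sort A) (@banach_scaleAl K A).
HB.instance Definition _ :=
  GRing.Lalgebra_isAlgebra.Build K (banach_sort A) (@banach_scaleAr K A).

End BanachAlgebraInstances.

Section MatrixInverse.
Variables (E : nzRingType) (n : nat).

(* [unitmx] and [invmx] are only available over commutative rings. When a is
   not invertible, [mx_inv a] is 0. *)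
Definition mx_inverse (a c : 'M[E]_n) : Prop :=
  a *m c = 1%:M /\ c *m a = 1%:M.

Definition mx_invertible (a : 'M[E]_n) : Prop := exists c, mx_inverse a c.

Definition mx_inv (a : 'M[E]_n) : 'M[E]_n := xget 0 [set c | mx_inverse a c].

End MatrixInverse.

Section Resolvent.
Variables (R : realType) (E : banachAlgebra R[i]).
Implicit Types (Y : E) (B : subalgClosed E).

Definition resolvent_set Y B n : set 'M[E]_n :=
  [set b | b \is a mxOver B /\ mx_invertible (Y%:M - b)].

Definition resolvent Y n (b : 'M[E]_n) : 'M[E]_n := mx_inv (b - Y%:M).

Definition RA Y B : {pred E} := [pred x | `[< forall S : subalgClosed E,
  {subset B <= S} -> Y \in S ->
  (forall n (b : 'M[E]_n), (0 < n)%N -> resolvent_set Y B b ->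
     forall i j, resolvent Y b i j \in S) ->
  x \in S >]].

Lemma RA_subalg_closed Y B : subalg_closed (RA Y B).
Proof.
split=> [|c x y /asboolP xS /asboolP yS|x y /asboolP xS /asboolP yS];
  apply/asboolP => S BS YS RS.
- exact: rpred1.
- by apply: rpredD; [apply: rpredZ; apply: xS | apply: yS].
- by apply: rpredM; [apply: xS | apply: yS].
Qed.

HB.instance Definition _ Y B :=
  GRing.isSubalgClosed.Build R[i] E (RA Y B)
    (GRing.subalg_closed_semi (@RA_subalg_closed Y B)).

Record RA_type Y B := RAElem { RA_val : E; _ : RA_val \in RA Y B }.

Section RAType.
Variables (Y : E) (B : subalgClosed E).

HB.instance Definition _ := [isSub for @RA_val Y B].
HB.instance Definition _ := [Choice of RA_type Y B by <:].
HB.instance Definition _ := [SubChoice_isSubAlgebra of RA_type Y B by <:].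

Lemma mem_RA_Y : Y \in RA Y B.
Proof. exact/asboolP. Qed.

Definition RA_Y : RA_type Y B := RAElem mem_RA_Y.

End RAType.

Definition Umap Y (phi : E -> R[i]) n (b : 'M[E]_n) : 'M[R[i]]_n :=
  map_mx phi (resolvent Y b).

Section PartialMN.
Variables (m n : nat) (f : 'M[E]_(m + n) -> 'M[R[i]]_(m + n)).
Variables (b1 : 'M[E]_m) (b2 : 'M[E]_n).

Definition partial_curve (i j : 'I_m) (k l : 'I_n) (eps : R[i]^o) : R[i]^o :=
  f (block_mx b1 0 0 b2
     + map_mx (in_alg E) ((eps : R[i]) *: delta_mx (lshift n j) (rshift m k)))
    (lshift n i) (rshift m l).

(* M_m (x) M_n is identified with M_{mn} through the Kronecker product *t, and
   likewise M_m (x) M_n (x) E with M_{mn}(E): the entries of x *t x' are the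
   products x_ij * x'_kl, so that *t over E is the product (x)_E.
   Only the values of f on the resolvent set matter: the perturbed matrix is
   block triangular, hence stays in it for all eps when b1 and b2 are in the
   resolvent sets. *)
Definition partial_mn : 'M[R[i]]_(m * n) :=
  \sum_(i < m) \sum_(j < m) \sum_(k < n) \sum_(l < n)
    ('D_1 (partial_curve i j k l) 0 : R[i]) *:
      (delta_mx i j *t delta_mx k l).

End PartialMN.
End Resolvent.

(* Main.v *)
(* Write [R1], [R2] for the resolvents at [b1], [b2].  Perturbing [b1 (+) b2] by
   [eps e_(j,k+m)] keeps the matrix minus [Y] block upper triangular, so its
   inverse is [R1], [- eps R1 e_(j,k) R2], [0], [R2] blockwise.  Every curve in the
   definition of [partial_mn] is therefore linear in [eps], with slope
   [- phi (R1 i j * R2 k l)]. *)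
Require Import Defs.
From HB Require Import structures.
From mathcomp Require Import all_boot all_order all_algebra.
From mathcomp Require Import complex mxtens.
From mathcomp Require Import boolp classical_sets reals topology normedtype derive.

Import Order.TTheory GRing.Theory Num.Theory.
Import numFieldNormedType.Exports.

Local Open Scope classical_set_scope.
Local Open Scope ring_scope.

(** A two-sided inverse is unique over any ring, so the choice made by [xget] is immaterial and
    exhibiting one inverse computes [mx_inv]. *)
Lemma mx_inv_eq (E : nzRingType) (n : nat) (a c : 'M[E]_n) :
  mx_inverse a c -> mx_inv a = c.
Proof.
move=> [ac ca]; apply: xget_unique => [|c' [ac' _]]; first by split.
by rewrite -[c']mul1mx -ca -mulmxA ac' mulmx1.
Qed.

Lemma mx_invP (E : nzRingType) (n : nat) (a : 'M[E]_n) :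
  mx_invertible a -> mx_inverse a (mx_inv a).
Proof. by move=> [c ac]; rewrite (mx_inv_eq _ _ _ _ ac). Qed.

Lemma mx_invertibleN (E : nzRingType) (n : nat) (a : 'M[E]_n) :
  mx_invertible a -> mx_invertible (- a).
Proof.
by move=> [c [ac ca]]; exists (- c); split; rewrite mulmxN mulNmx opprK.
Qed.

(** Bridges a sign: [resolvent_set] speaks of [Y - b], while [resolvent] inverts [b - Y]. *)
Lemma resolventP (R : realType) (E : banachAlgebra R[i]) (B : subalgClosed E)
    (Y : E) (n : nat) (b : 'M[E]_n) :
  resolvent_set Y B b -> mx_inverse (b - Y%:M) (resolvent Y b).
Proof.
by move=> [_ /mx_invertibleN Yb]; apply: mx_invP; rewrite -opprB.
Qed.

(** The corner [x] of the inverse is forced by [a1 x + u c2 = 0]; multiply on the left by [c1]. *)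
Lemma mx_inverse_ublock (E : nzRingType) (m n : nat)
    (a1 c1 : 'M[E]_m) (u : 'M[E]_(m, n)) (a2 c2 : 'M[E]_n) :
  mx_inverse a1 c1 -> mx_inverse a2 c2 ->
  mx_inverse (block_mx a1 u 0 a2) (block_mx c1 (- (c1 *m u *m c2)) 0 c2).
Proof.
move=> [ac1 ca1] [ac2 ca2]; split; rewrite mulmx_block.
  rewrite !mulmxN !mulmxA ac1 ac2 mul1mx !mulmx0 !mul0mx oppr0 !addr0 add0r.
  by rewrite addNr -scalar_mx_block.
rewrite !mulNmx -(mulmxA _ c2 a2) ca1 ca2 mulmx1 !mulmx0 !mul0mx oppr0 !addr0.
rewrite add0r addrN.
by rewrite -scalar_mx_block.
Qed.

(** Subtracting [Y%:M] changes only the diagonal blocks, so [u] is arbitrary and need not be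
    small. *)
Lemma resolvent_ublock (R : realType) (E : banachAlgebra R[i])
    (B : subalgClosed E) (Y : E) (m n : nat)
    (b1 : 'M[E]_m) (u : 'M[E]_(m, n)) (b2 : 'M[E]_n) :
  resolvent_set Y B b1 -> resolvent_set Y B b2 ->
  resolvent Y (block_mx b1 u 0 b2) =
    block_mx (resolvent Y b1) (- (resolvent Y b1 *m u *m resolvent Y b2))
             0 (resolvent Y b2).
Proof.
move=> /resolventP Rb1 /resolventP Rb2; apply: mx_inv_eq.
rewrite scalar_mx_block opp_block_mx add_block_mx !oppr0 !addr0.
exact: mx_inverse_ublock.
Qed.

(** The matrix unit pairs column [j] of [A] with row [k] of [C]. Scalars are central in [E], so [c]
    moves out while the order of the two entries is kept. *)
Lemma mulmx_in_alg_delta_mulmxE (K : comNzRingType) (E : algType K)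
    (m n p q : nat) (A : 'M[E]_(m, n)) (C : 'M[E]_(p, q)) (c : K) i j k l :
  (A *m map_mx (in_alg E) (c *: delta_mx j k) *m C) i l = c *: (A i j * C k l).
Proof.
rewrite mxE (bigD1 k) //= big1 => [|k' ne]; last first.
  rewrite mxE big1 ?mul0r // => j' _.
  by rewrite !mxE (negPf ne) andbF mulr0 rmorph0 mulr0.
rewrite addr0 mxE (bigD1 j) //= big1 => [|j' ne].
  by rewrite !mxE !eqxx mulr1 addr0 /= -scalerAr mulr1 scalerAl.
by rewrite !mxE (negPf ne) mulr0 rmorph0 mulr0.
Qed.

(** Kronecker products of matrix units are again matrix units, so each entry isolates one
    coefficient; this reads off the entries of [partial_mn]. *)
Lemma sum_tens_deltaE (K : comNzRingType) (m n p q : nat)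
    (c : 'I_m -> 'I_n -> 'I_p -> 'I_q -> K) i j k l :
  (\sum_i' \sum_j' \sum_k' \sum_l'
     c i' j' k' l' *: (delta_mx i' j' *t delta_mx k' l'))
    (mxtens_index (i, k)) (mxtens_index (j, l)) = c i j k l.
Proof.
rewrite summxE (bigD1 i) //= [X in _ + X]big1 ?addr0 => [|i' ne].
  rewrite summxE (bigD1 j) //= [X in _ + X]big1 ?addr0 => [|j' ne].
    rewrite summxE (bigD1 k) //= [X in _ + X]big1 ?addr0 => [|k' ne].
      rewrite summxE (bigD1 l) //= [X in _ + X]big1 ?addr0 => [|l' ne].
        by rewrite mxE tensmxE !mxE !eqxx !mulr1.
      by rewrite mxE tensmxE !mxE (eq_sym l) (negPf ne) andbF !mulr0.
    rewrite summxE big1 // => l' _.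
    by rewrite mxE tensmxE !mxE (eq_sym k) (negPf ne) !mulr0.
  rewrite summxE big1 // => k' _; rewrite summxE big1 // => l' _.
  by rewrite mxE tensmxE !mxE (eq_sym j) (negPf ne) andbF mul0r mulr0.
rewrite summxE big1 // => j' _; rewrite summxE big1 // => k' _.
rewrite summxE big1 // => l' _.
by rewrite mxE tensmxE !mxE (eq_sym i) (negPf ne) mul0r mulr0.
Qed.

Lemma partial_curve_UmapE (R : realType) (E : banachAlgebra R[i])
    (B : subalgClosed E) (Y : E) (phi : {linear E -> R[i]^o}) (m n : nat)
    (b1 : 'M[E]_m) (b2 : 'M[E]_n) i j k l :
  resolvent_set Y B b1 -> resolvent_set Y B b2 ->
  partial_curve (Umap Y phi (n := m + n)) b1 b2 i j k l =
    (fun eps => - phi (resolvent Y b1 i j * resolvent Y b2 k l) *: eps).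
Proof.
move=> hb1 hb2; apply/funext => eps; rewrite /partial_curve /Umap mxE.
have -> : block_mx b1 0 0 b2 +
    map_mx (in_alg E) ((eps : R[i]) *: delta_mx (lshift n j) (rshift m k)) =
      block_mx b1 (map_mx (in_alg E) ((eps : R[i]) *: delta_mx j k)) 0 b2.
  (* The perturbing matrix unit lies wholly in the upper right block. *)
  have -> : delta_mx (lshift n j) (rshift m k) =
      block_mx 0 (delta_mx j k) 0 0 :> 'M[R[i]]_(m + n).
    apply/matrixP => r s; rewrite -[r]splitK -[s]splitK.
    case: (split r) => r'; case: (split s) => s' /=;
      by rewrite ?(block_mxEul, block_mxEur, block_mxEdl, block_mxEdr) !mxE
        ?eq_shift ?andbF.
  rewrite scale_block_mx map_block_mx add_block_mx !scaler0 !map_mx0.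
  by rewrite !addr0 add0r.
rewrite (resolvent_ublock _ _ _ _ _ _ _ _ _ hb1 hb2) block_mxEur mxE.
rewrite mulmx_in_alg_delta_mulmxE linearN linearZ /=.
(* In [R[i]^o] scaling is multiplication, so scalar and vector may be exchanged. *)
by rewrite scaleNr; congr (- _); apply: mulrC.
Qed.

Theorem proposition9p8 (R : realType) (E : banachAlgebra R[i])
  (B : subalgClosed E) (B_closed : closed [set x : E | x \in B]) (Y : E)
  (RA_dense : dense [set x : E | x \in RA Y B])
  (d : {linear RA_type Y B -> tensor (RA_type Y B) (RA_type Y B)})
  (d_GDQ : GDQ_ring d)
  (d_B : forall x : RA_type Y B, \val x \in B -> d x = 0)
  (d_Y : d (RA_Y Y B) = tens 1 1)
  (phi : {linear E -> R[i]^o}) (phi_continuous : continuous phi)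
  (m n : nat) (m_gt0 : (0 < m)%N) (n_gt0 : (0 < n)%N)
  (b1 : 'M[E]_m) (b2 : 'M[E]_n)
  (hb1 : resolvent_set Y B b1) (hb2 : resolvent_set Y B b2) :
  (forall i j k l,
     derivable (partial_curve (Umap Y phi (n := m + n)) b1 b2 i j k l) 0 1) /\
  map_mx phi (resolvent Y b1 *t resolvent Y b2) =
    - partial_mn (Umap Y phi (n := m + n)) b1 b2.
Proof.
(* [is_derive] carries both existence and value of the derivative, one for each conjunct. *)
have curve_derive i j k l : is_derive (0 : R[i]^o) 1
    (partial_curve (Umap Y phi (n := m + n)) b1 b2 i j k l)
    (- phi (resolvent Y b1 i j * resolvent Y b2 k l)).
  rewrite (partial_curve_UmapE _ _ B) //.
  (* The factor 1 is the derivative of the identity, as the rule for scalar multiples produces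
     it. *)
  set c := - phi _; rewrite -[X in is_derive _ _ _ X](mulr1 c).
  exact: (is_deriveZ (V := R[i]^o) (W := R[i]^o) c (is_derive_id (0 : R[i]^o) 1)).
split=> [i j k l|]; first by have [] := curve_derive i j k l.
apply/matrixP => r s.
(* Every index of the Kronecker product is a pair, so the claim reduces to one slope per [i], [j],
   [k], [l]; its sign cancels the outer one. *)
case: (mxtens_indexP r) => i k; case: (mxtens_indexP s) => j l.
rewrite mxE tensmxE mxE sum_tens_deltaE.
by rewrite (@derive_val _ _ _ _ _ _ _ (curve_derive i j k l)) opprK.
Qed.
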